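(* Let $G=(V,E)$ be a $d$-regular graph on $n=|V|$ vertices with adjacency matrix $A$, and let $L = I - \frac{1}{d}A$ be its normalized Laplacian. For any $\delta \le 1/2$, $$\lambda_\delta \le \phi_\delta(G) \le \sqrt{(2-\lambda_\delta)\lambda_\delta},$$ where $\lambda_\delta = \min_{x\in\mathbb{R}^n,\ \|x\|_0 = \delta |V|} \frac{x^T L x}{x^T x}$.
   Context: For nonempty $S \subseteq V$, the expansion is $\phi_G(S) = \frac{|E(S,V\setminus S)|}{d\cdot \min(|S|,|V\setminus S|)}$, where $E(S,V\setminus S)$ is the set of edges with one endpoint in $S$ and the other in $V\setminus S$. For $0<\delta\le 1/2$, $\phi_\delta(G) = \min\{\phi_G(S) : S\subseteq V,\ S\neq\emptyset,\ |S|\le \delta n\}$. $\|x\|_0$ denotes the number of nonzero coordinates of $x$.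
   Formalization: The minimum defining λ_δ need not be attained and δ|V| need not be an integer, so λ_δ is taken as the infimum over ‖x‖₀ = ⌊δ|V|⌋; d ≥ 1, δ > 0 and δ|V| ≥ 1 are assumed so that L, φ_δ and λ_δ are defined. *)

(* Defs.v *)
From mathcomp Require Import all_boot all_order all_algebra.
From mathcomp Require Import classical_sets reals.

Set Implicit Arguments.
Unset Strict Implicit.
Unset Printing Implicit Defensive.

Import Order.TTheory GRing.Theory Num.Theory.

Local Open Scope ring_scope.

Record sgraph (V : finType) := SGraph {
  adj : rel V;
  adj_sym : symmetric adj;
  adj_irr : irreflexive adj
}.

Section Graph.
Variables (V : finType) (G : sgraph V).

Definition regular (d : nat) : Prop :=
  forall v : V, #|[set u | adj G v u]| = d.

(* Edges are unordered pairs [set u; v]. *)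
Definition edges_between (S T : {set V}) : {set {set V}} :=
  [set [set u; v] | u in S, v in T & adj G u v].

Variable R : realType.

Definition expansion (d : nat) (S : {set V}) : R :=
  #|edges_between S (~: S)|%:R / (d%:R * (minn #|S| #|~: S|)%:R).

(* The set is finite, so its infimum is a minimum as soon as it is nonempty,
   i.e. when 1 <= delta * #|V|; see small_set_expansion_min. *)
Definition small_set_expansion (d : nat) (delta : R) : R :=
  inf [set r | exists S : {set V},
    [/\ S != finset.set0, #|S|%:R <= delta * #|V|%:R & r = expansion d S]]%classic.

(* Vertices are indexed by 'I_#|V| through the enumeration of V. *)
Definition adjacency_mx : 'M[R]_#|V| :=
  \matrix_(i, j) (adj G (enum_val i) (enum_val j))%:R.

Definition laplacian_mx (d : nat) : 'M[R]_#|V| :=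
  1%:M - d%:R^-1 *: adjacency_mx.

End Graph.

Section Sparse.
Variable R : realType.

Definition norm0 (n : nat) (x : 'cV[R]_n) : nat := #|[set i | x i 0 != 0]|.

Definition rayleigh (n : nat) (L : 'M[R]_n) (x : 'cV[R]_n) : R :=
  (x^T *m L *m x) 0 0 / (x^T *m x) 0 0.

(* The sparsity level delta * n is rounded down, so that the constraint makes
   sense for every delta; it is the exact condition norm0 x = delta * n when
   delta * n is an integer (norm0_trunc). The "minimum" is an infimum: the set
   of vectors with exactly k nonzero coordinates is not closed, and the
   minimum need not be attained (three disjoint triangles, k = 4). *)
Definition sparse_eigenvalue (n : nat) (L : 'M[R]_n) (delta : R) : R :=
  inf [set r | exists x : 'cV[R]_n,
    norm0 x = Num.truncn (delta * n%:R) /\ r = rayleigh L x]%classic.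

End Sparse.

Lemma norm0_trunc (R : realType) (n k : nat) (delta : R) (x : 'cV[R]_n) :
  delta * n%:R = k%:R ->
  norm0 x = Num.truncn (delta * n%:R) <-> (norm0 x)%:R = delta * n%:R.
Proof.
move=> ->; rewrite natrK; split=> [->//|/eqP].
by rewrite eqr_nat => /eqP.
Qed.

Lemma small_set_expansion_min (V : finType) (G : sgraph V) (R : realType)
    (d : nat) (delta : R) :
  1 <= delta * #|V|%:R ->
  exists S : {set V},
    [/\ S != finset.set0, #|S|%:R <= delta * #|V|%:R,
        small_set_expansion G d delta = expansion G R d S &
        forall T : {set V}, T != finset.set0 -> #|T|%:R <= delta * #|V|%:R ->
          expansion G R d S <= expansion G R d T].
Proof.
move=> d1.
have [v _] : exists v : V, v \in V.
  apply/card_gt0P; rewrite lt0n; apply: contraTN d1 => /eqP ->.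
  by rewrite mulr0 ler10.
pose P (S : {set V}) := (S != finset.set0) && (#|S|%:R <= delta * #|V|%:R).
have P0 : P [set v].
  by rewrite /P cards1 d1 andbT; apply/finset.set0Pn; exists v; rewrite inE.
case: (arg_minP (expansion G R d) P0) => S /andP[S0 Sd] minS.
have minT (T : {set V}) : T != finset.set0 -> #|T|%:R <= delta * #|V|%:R ->
    expansion G R d S <= expansion G R d T.
  by move=> T0 Td; apply: minS; rewrite /P T0.
exists S; split=> //; apply/eqP; rewrite eq_le; apply/andP; split.
  apply: ge_inf; last by exists S.
  by exists (expansion G R d S) => _ [T [T0 Td ->]]; apply: minT.
apply: lb_le_inf; first by exists (expansion G R d S), S.
by move=> _ [T [T0 Td ->]]; apply: minT.
Qed.

(* Main.v *)
Require Import Defs.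
From mathcomp Require Import classical_sets reals.
From mathcomp Require Import all_boot all_order all_algebra.
From mathcomp Require Import ring lra.

Set Implicit Arguments.
Unset Strict Implicit.
Unset Printing Implicit Defensive.

Import Order.TTheory GRing.Theory Num.Theory.

Local Open Scope ring_scope.

(* Write [k] for the integer part of [delta * #|V|].

   Lower bound: the indicator of a set [S] with at most [k <= #|V| / 2] vertices
   has Rayleigh quotient equal to the expansion of [S], and it is a limit of
   vectors with exactly [k] nonzero entries.

   Upper bound: let [x] have [k] nonzero entries and Rayleigh quotient [rho].
   Every superlevel set of [x ^ 2] has at most [k] vertices, so the coarea
   inequality bounds the sum of [|x_u ^ 2 - x_v ^ 2|] over edges from below by
   [phi * d * |x| ^ 2]. Factoring [x_u ^ 2 - x_v ^ 2] and applying
   Cauchy-Schwarz bounds it from above by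
   [d * |x| ^ 2 * sqrt (rho * (2 - rho))], because the Dirichlet sums of
   [x_u - x_v] and [x_u + x_v] are [d * rho * |x| ^ 2] and
   [d * (2 - rho) * |x| ^ 2]. The resulting [phi ^ 2 <= (2 - rho) * rho]
   confines [rho] to a closed interval, so it passes to the infimum. *)

Lemma ex_subset_card (T : finType) (B : {set T}) (k : nat) :
  (k <= #|B|)%N -> exists2 A : {set T}, A \subset B & #|A| = k.
Proof.
rewrite -bin_gt0 -cards_draws => /card_gt0P[A].
by rewrite inE => /andP[AB /eqP Ak]; exists A.
Qed.

Lemma sum_indicator (R : pzSemiRingType) (T : finType) (S : {set T}) :
  \sum_t (t \in S)%:R = #|S|%:R :> R.
Proof.
by rewrite -sumr_const [RHS]big_mkcond; apply: eq_bigr => t _; rewrite mulrb.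
Qed.

Lemma cauchy_schwarz_sum (R : realDomainType) (I : Type) (r : seq I)
    (P : pred I) (p q : I -> R) :
  (\sum_(i <- r | P i) p i * q i) ^+ 2 <=
  (\sum_(i <- r | P i) p i ^+ 2) * (\sum_(i <- r | P i) q i ^+ 2).
Proof.
set pq := \sum_(i <- r | P i) _; set p2 := \sum_(i <- r | P i) p i ^+ 2.
set q2 := \sum_(i <- r | P i) q i ^+ 2.
have lagrange : \sum_(i <- r | P i) \sum_(j <- r | P j)
    (p i * q j - p j * q i) ^+ 2 = (p2 * q2 - pq ^+ 2) *+ 2.
  rewrite mulr2n {2}[p2 * q2]mulrC expr2 !big_distrlr -!sumrB -big_split.
  apply: eq_bigr => i _; rewrite -!sumrB -big_split.
  by apply: eq_bigr => j _ /=; ring.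
rewrite -subr_ge0 -(pmulrn_lge0 _ (ltn0Sn 1)) -lagrange.
by do 2!(apply: sumr_ge0 => ? _); apply: sqr_ge0.
Qed.

Lemma ge0_of_quadratic_ge0 (R : realFieldType) (a b c : R) :
  (forall e, 0 < e -> 0 <= a + e * b + e ^+ 2 * c) -> 0 <= a.
Proof.
move=> ge0; rewrite leNgt; apply/negP => a_lt0.
pose m := `|b| + `|c| - a; pose e := - a / (2 * m).
have [b_ge0 c_ge0] := (normr_ge0 b, normr_ge0 c).
have m2_gt0 : 0 < 2 * m by rewrite /m; lra.
have e_gt0 : 0 < e by rewrite divr_gt0 ?oppr_gt0.
have e_le1 : e <= 1 by rewrite ler_pdivrMr // /m; lra.
have em : e * (2 * m) = - a by rewrite divfK ?gt_eqF.
have eb : e * b <= e * `|b| by rewrite ler_pM2l ?ler_norm.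
have ec : e ^+ 2 * c <= e * `|c|.
  apply: le_trans (_ : e ^+ 2 * `|c| <= _).
    by rewrite ler_wpM2l ?sqr_ge0 ?ler_norm.
  by rewrite expr2 -mulrA ler_pM2l // ler_piMl.
have ea : e * a < 0 by rewrite pmulr_rlt0.
have := ge0 e e_gt0; rewrite /m in em; lra.
Qed.

Lemma le_parabola_inf (R : realType) (A : set R) (a c : R) :
  (A !=set0)%classic -> (forall r, A r -> c <= (a - r) * r) ->
  c <= (a - inf A) * inf A.
Proof.
have complete_square (r : R) : (a - r) * r = (a / 2) ^+ 2 - (a / 2 - r) ^+ 2.
  by field.
move=> A_neq0 A_ge; have [r0 Ar0] := A_neq0.
pose s := Num.sqrt ((a / 2) ^+ 2 - c).
have dist_le r : A r -> a / 2 - s <= r <= a / 2 + s.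
  move=> /A_ge; rewrite complete_square => c_le.
  rewrite -ler_distlC -sqrtr_sqr; apply: ler_wsqrtr; lra.
have lb_s : lbound A (a / 2 - s) by move=> r /dist_le/andP[].
have inf_ge : a / 2 - s <= inf A by apply: lb_le_inf.
have inf_le : inf A <= a / 2 + s.
  have /andP[_] := dist_le r0 Ar0; apply: le_trans.
  by apply: ge_inf Ar0; exists (a / 2 - s).
have s_sqr : s ^+ 2 = (a / 2) ^+ 2 - c.
  rewrite sqr_sqrtr //; have := A_ge r0 Ar0.
  by rewrite complete_square; have := sqr_ge0 (a / 2 - r0); lra.
rewrite complete_square -[leLHS](subKr ((a / 2) ^+ 2)) -s_sqr lerB //.
rewrite -[leLHS]real_normK ?num_real // ler_sqr ?nnegrE ?sqrtr_ge0 //.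
by rewrite ler_distlC inf_ge.
Qed.

Lemma double_truncn_half (R : archiRealFieldType) (delta : R) (n : nat) :
  0 <= delta -> delta <= 1 / 2 -> ((Num.truncn (delta * n%:R)).*2 <= n)%N.
Proof.
move=> delta_ge0 delta_le; rewrite -(ler_nat R) -muln2 natrM.
have : (Num.truncn (delta * n%:R))%:R <= delta * n%:R.
  by rewrite truncn_le mulr_ge0.
have := ler_wpM2r (ler0n R n) delta_le; lra.
Qed.

Section Support.
Variable T : finType.
Implicit Type S : {set T}.

Definition supp (M : nmodType) (f : T -> M) : {set T} := [set t | f t != 0].

Lemma notin_supp (M : nmodType) (f : T -> M) t : t \notin supp f -> f t = 0.
Proof. by rewrite inE negbK => /eqP. Qed.

Lemma supp_sqr (R : idomainType) (f : T -> R) :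
  supp (fun t => f t ^+ 2) = supp f.
Proof. by apply/setP => t; rewrite !inE sqrf_eq0. Qed.

Lemma supp_indicator (R : nzSemiRingType) S :
  supp (fun t => (t \in S)%:R : R) = S.
Proof.
by apply/setP => t; rewrite inE; case: (t \in S); rewrite ?oner_eq0 ?eqxx.
Qed.

Lemma sum_sqr_gt0 (R : realDomainType) (f : T -> R) :
  supp f != set0 -> 0 < \sum_t f t ^+ 2.
Proof.
move=> /set0Pn[t]; rewrite inE => ft_neq0.
rewrite (bigD1 t) //= ltr_pwDl ?sumr_ge0 // => [|u _]; last exact: sqr_ge0.
by rewrite lt_neqAle eq_sym sqrf_eq0 ft_neq0 sqr_ge0.
Qed.

Lemma peel_lowest_level (R : realDomainType) (f : T -> R) :
  (forall t, 0 <= f t) -> supp f != set0 ->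
  exists a (g : T -> R), [/\ 0 <= a, forall t, 0 <= g t, supp g \proper supp f
    & forall t, f t = a * (t \in supp f)%:R + g t].
Proof.
move=> f_ge0 /set0Pn[t0 t0_supp].
case: (arg_minP f t0_supp) => w w_supp f_min.
have {}w_supp : w \in supp f by [].
pose g t := f t - f w * (t \in supp f)%:R.
have g_out t : t \notin supp f -> g t = 0.
  by move=> t_out; rewrite /g notin_supp // (negPf t_out) mulr0 subr0.
exists (f w), g; split=> [|t||t]; first exact: f_ge0.
- have [t_supp|/g_out->//] := boolP (t \in supp f).
  by rewrite /g t_supp mulr1 subr_ge0 f_min.
- apply/properP; split; last first.
    by exists w => //; rewrite inE /g w_supp mulr1 subrr eqxx.
  by apply/subsetP => t; rewrite inE; apply: contraR => /g_out->.
- by rewrite /g addrC subrK.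
Qed.

Lemma dist_indicatorD (R : realDomainType) S (a : R) (g : T -> R) u v :
  0 <= a -> (forall t, 0 <= g t) -> supp g \subset S ->
  `|(a * (u \in S)%:R + g u) - (a * (v \in S)%:R + g v)| =
  a * `|(u \in S)%:R - (v \in S)%:R| + `|g u - g v|.
Proof.
move=> a_ge0 g_ge0 gS.
have g_out t : t \notin S -> g t = 0.
  by move=> tS; apply/notin_supp/(contra _ tS)/(subsetP gS).
have agE t : `|a + g t| = a + `|g t| by rewrite !ger0_norm ?addr_ge0.
have [uS|/g_out->] := boolP (u \in S); have [vS|/g_out->] := boolP (v \in S);
  rewrite /= ?mulr1 ?mulr0 ?addr0 ?subr0 ?sub0r ?normrN ?normr1 ?mulr1 //.
- by rewrite subrr normr0 mulr0 add0r opprD addrACA subrr add0r.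
- by rewrite normr0 mulr0 addr0.
Qed.

End Support.

Section Arcs.
Variables (V : finType) (G : sgraph V).
Implicit Types S T : {set V}.

Definition arcs : {set V * V} := [set e | adj G e.1 e.2].

Lemma sum_arcsE (M : nmodType) (F : V -> V -> M) :
  \sum_(e in arcs) F e.1 e.2 = \sum_u \sum_(v | adj G u v) F u v.
Proof. by rewrite pair_big_dep; apply: eq_bigl => e; rewrite inE. Qed.

Lemma sum_arcs_swap (M : nmodType) (F : V -> V -> M) :
  \sum_(e in arcs) F e.2 e.1 = \sum_(e in arcs) F e.1 e.2.
Proof.
rewrite (reindex_inj (inv_inj swap_pairK)) /=.
by apply: eq_bigl => e; rewrite !inE /= adj_sym.
Qed.

Lemma set2_inj_disjoint S T : [disjoint S & T] ->
  {in setX S T &, injective (fun e => [set e.1; e.2])}.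
Proof.
move=> dST [u v] [u' v']; rewrite !in_setX /=.
move=> /andP[uS vT] /andP[u'S v'T] /setP set2E; congr pair; apply/eqP.
  move: (set2E u); rewrite !inE eqxx => /esym/orP[//|/eqP uv'].
  by rewrite -uv' (disjointFr dST uS) in v'T.
move: (set2E v); rewrite !inE eqxx orbT => /esym/orP[/eqP vu'|//].
by rewrite vu' (disjointFr dST u'S) in vT.
Qed.

Lemma card_edges_between S T : [disjoint S & T] ->
  #|edges_between G S T| = #|arcs :&: setX S T|.
Proof.
move=> /set2_inj_disjoint set2_inj.
rewrite -(card_in_imset (sub_in2 _ set2_inj)); last first.
  by move=> e /setIP[].
congr #|pred_of_set _|; apply/setP => e.
apply/imset2P/imsetP => [[u v uS]|[[u v]]].
  by rewrite inE => /andP[vT uv] ->; exists (u, v); rewrite // !inE /= uv uS.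
by rewrite !inE /= => /and3P[uv uS vT] ->; exists u v; rewrite // inE vT.
Qed.

Definition cut_size S : nat := #|edges_between G S (~: S)|.

Lemma sum_arcs_cut (R : realDomainType) S :
  \sum_(e in arcs) `|(e.1 \in S)%:R - (e.2 \in S)%:R| =
  (cut_size S)%:R *+ 2 :> R.
Proof.
rewrite /cut_size card_edges_between; last by rewrite -setI_eq0 setICr.
have -> : #|arcs :&: setX S (~: S)|%:R =
    \sum_(e in arcs) ((e.1 \in S) && (e.2 \notin S))%:R :> R.
  rewrite -sum_indicator [RHS]big_mkcond; apply: eq_bigr => e _.
  by rewrite !inE; case: adj.
rewrite mulr2n -{2}(sum_arcs_swap (fun u v => ((u \in S) && (v \notin S))%:R)).
rewrite -big_split; apply: eq_bigr => e _ /=.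
case: (e.1 \in S); case: (e.2 \in S);
  by rewrite ?subrr ?sub0r ?subr0 ?normrN ?normr0 ?normr1 ?addr0 ?add0r.
Qed.

Definition cut_ratio_ge (R : numDomainType) (c : R) (k : nat) : Prop :=
  forall S, (0 < #|S| <= k)%N -> c * #|S|%:R <= (cut_size S)%:R.

Lemma sum_arcs_coarea (R : realDomainType) (c : R) (k : nat) (f : V -> R) :
  cut_ratio_ge c k -> (forall u, 0 <= f u) -> (#|supp f| <= k)%N ->
  (c * \sum_u f u) *+ 2 <= \sum_(e in arcs) `|f e.1 - f e.2|.
Proof.
move=> cut_ge; have [m] := ubnP #|supp f|.
elim: m f => // m IHm f; rewrite ltnS => le_m f_ge0 le_k.
have [supp0|supp_neq0] := eqVneq (supp f) set0.
  rewrite big1 ?mulr0 ?mul0rn ?sumr_ge0 // => u _.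
  by rewrite notin_supp // supp0 inE.
have [a [g [a_ge0 g_ge0 lt_supp fE]]] := peel_lowest_level f_ge0 supp_neq0.
have lt_card := proper_card lt_supp.
have coarea_g :=
  IHm g (leq_trans lt_card le_m) g_ge0 (leq_trans (ltnW lt_card) le_k).
have -> : \sum_u f u = a * #|supp f|%:R + \sum_u g u.
  rewrite -sum_indicator mulr_sumr -big_split.
  by apply: eq_bigr => u _; rewrite {1}fE.
have -> : \sum_(e in arcs) `|f e.1 - f e.2| =
    (a * (cut_size (supp f))%:R) *+ 2
    + \sum_(e in arcs) `|g e.1 - g e.2|.
  rewrite -mulrnAr -sum_arcs_cut mulr_sumr -big_split; apply: eq_bigr => e _.
  by rewrite {1}(fE e.1) {1}(fE e.2) dist_indicatorD ?(proper_sub lt_supp).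
rewrite mulrDr mulrnDl lerD // lerMn2r /= mulrCA ler_wpM2l //.
by rewrite cut_ge // card_gt0 supp_neq0.
Qed.

Lemma cheeger_sum_arcs (R : realDomainType) (c : R) (k : nat) (f : V -> R) :
  0 <= c -> cut_ratio_ge c k -> (#|supp f| <= k)%N ->
  ((c * \sum_u f u ^+ 2) *+ 2) ^+ 2 <=
  (\sum_(e in arcs) (f e.1 - f e.2) ^+ 2) *
  (\sum_(e in arcs) (f e.1 + f e.2) ^+ 2).
Proof.
move=> c_ge0 cut_ge le_k.
have coarea : (c * \sum_u f u ^+ 2) *+ 2 <=
    \sum_(e in arcs) `|f e.1 - f e.2| * `|f e.1 + f e.2|.
  under [leRHS]eq_bigr do rewrite -normrM -subr_sqr.
  apply: (sum_arcs_coarea (f := fun u => f u ^+ 2)) cut_ge _ _ => [u|].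
    exact: sqr_ge0.
  by rewrite supp_sqr.
have sum_ge0 : 0 <= (c * \sum_u f u ^+ 2) *+ 2.
  by rewrite mulrn_wge0 // mulr_ge0 // sumr_ge0 // => u _; apply: sqr_ge0.
under [X in _ <= X * _]eq_bigr do rewrite -real_normK ?num_real //.
under [X in _ <= _ * X]eq_bigr do rewrite -real_normK ?num_real //.
apply: le_trans (cauchy_schwarz_sum _ _ _ _).
by rewrite ler_sqr ?nnegrE // (le_trans sum_ge0).
Qed.

Section Regular.
Variables (d : nat) (G_regular : regular G d).

Lemma sum_arcs_fst (M : nmodType) (f : V -> M) :
  \sum_(e in arcs) f e.1 = (\sum_u f u) *+ d.
Proof.
rewrite (sum_arcsE (fun u _ => f u)) -sumrMnl; apply: eq_bigr => u _.
rewrite -(G_regular u) -sumr_const.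
by apply: eq_bigl => v; rewrite inE.
Qed.

Lemma sum_arcs_sqrD (R : comPzRingType) (f g : V -> R) :
  \sum_(e in arcs) (f e.1 + g e.2) ^+ 2 =
  (\sum_u f u ^+ 2 + \sum_u g u ^+ 2) *+ d
  + (\sum_(e in arcs) f e.1 * g e.2) *+ 2.
Proof.
rewrite mulrnDl -!sum_arcs_fst -(sum_arcs_swap (fun u _ => g u ^+ 2)).
rewrite -sumrMnl -!big_split; apply: eq_bigr => e _ /=.
by rewrite sqrrD addrAC.
Qed.

End Regular.
End Arcs.

Section QuadraticForm.
Variables (R : comPzRingType) (n : nat).
Implicit Types (L M : 'M[R]_n) (x y : 'cV[R]_n).

Definition quad_form L x : R := (x^T *m L *m x) 0 0.

Definition sqr_norm x : R := (x^T *m x) 0 0.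

Definition indicator_col (A : {set 'I_n}) : 'cV[R]_n := \col_i (i \in A)%:R.

Lemma quad_formE L x : quad_form L x = \sum_i \sum_j x i 0 * L i j * x j 0.
Proof.
rewrite /quad_form mxE exchange_big; apply: eq_bigr => j _.
by rewrite mxE mulr_suml; apply: eq_bigr => i _; rewrite mxE.
Qed.

Lemma sqr_normE x : sqr_norm x = \sum_i x i 0 ^+ 2.
Proof. by rewrite /sqr_norm mxE; apply: eq_bigr => i _; rewrite mxE expr2. Qed.

Lemma quad_formDZ L x y e :
  quad_form L (x + e *: y) =
  quad_form L x + e * ((x^T *m L *m y) 0 0 + (y^T *m L *m x) 0 0)
  + e ^+ 2 * quad_form L y.
Proof.
rewrite /quad_form [(x + _)^T]linearD /= [(e *: y)^T]linearZ /=.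
rewrite !mulmxDl !mulmxDr -!scalemxAl -!scalemxAr !mxE; ring.
Qed.

Lemma quad_formB L M x : quad_form (L - M) x = quad_form L x - quad_form M x.
Proof. by rewrite /quad_form mulmxBr mulmxBl !mxE. Qed.

Lemma quad_formZ (c : R) L x : quad_form (c *: L) x = c * quad_form L x.
Proof. by rewrite /quad_form -scalemxAr -scalemxAl mxE. Qed.

Lemma quad_form1 x : quad_form 1%:M x = sqr_norm x.
Proof. by rewrite /quad_form mulmx1. Qed.

End QuadraticForm.

Section SparseVectors.
Variables (R : realType) (n : nat).
Implicit Types (L : 'M[R]_n) (x y : 'cV[R]_n).

Lemma sqr_norm_gt0 x : (0 < norm0 x)%N -> 0 < sqr_norm x.
Proof. by rewrite card_gt0 sqr_normE; apply: sum_sqr_gt0. Qed.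

Lemma rayleighK L x :
  (0 < norm0 x)%N -> rayleigh L x * sqr_norm x = quad_form L x.
Proof. by move=> /sqr_norm_gt0/lt0r_neq0 x_neq0; rewrite divfK. Qed.

Lemma norm0_indicator_col (A : {set 'I_n}) :
  norm0 (indicator_col R A) = #|A|.
Proof.
by rewrite -{2}(supp_indicator R A); apply: eq_card => i; rewrite !inE mxE.
Qed.

Lemma ex_norm0 k : (k <= n)%N -> exists x : 'cV[R]_n, norm0 x = k.
Proof.
move=> le_kn; have [|A _ card_A] := @ex_subset_card _ [set: 'I_n] k.
  by rewrite cardsT card_ord.
by exists (indicator_col R A); rewrite norm0_indicator_col.
Qed.

(* [x] is the limit, as [e] tends to [0], of the vectors [x + e *: y], where [y]
   is the indicator of [k - norm0 x] zeros of [x]. *)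
Lemma quad_form_ge0_sparse L k x :
  (norm0 x <= k <= n)%N ->
  (forall y, norm0 y = k -> 0 <= quad_form L y) -> 0 <= quad_form L x.
Proof.
move=> /andP[le_xk le_kn] form_ge0; pose X := supp (fun i => x i 0).
have [|D sDX card_D] := @ex_subset_card _ (~: X) (k - #|X|).
  by rewrite (cardsCs (~: X)) setCK card_ord leq_sub2r.
have norm0_xD (e : R) : 0 < e -> norm0 (x + e *: indicator_col R D) = k.
  move=> e_gt0; rewrite -(subnKC le_xk) -[norm0 x]/#|X| -card_D.
  have disjXD : [disjoint X & D] by rewrite disjoint_sym disjoints_subset.
  have /eqP<- : #|X :|: D| == (#|X| + #|D|)%N by rewrite (leq_card_setU X D).2.
  apply: eq_card => i; rewrite inE in_setU !mxE.
  have [iD|_] := boolP (i \in D); last by rewrite mulr0 addr0 orbF inE.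
  rewrite orbT mulr1 (notin_supp (f := fun i => x i 0)) ?add0r ?gt_eqF //.
  by rewrite (disjointFl disjXD).
apply: ge0_of_quadratic_ge0 => e /norm0_xD/form_ge0.
by rewrite quad_formDZ; apply.
Qed.

Lemma rayleigh_ge_sparse L k (c : R) x :
  (0 < norm0 x <= k)%N -> (k <= n)%N ->
  (forall y, norm0 y = k -> c <= rayleigh L y) -> c <= rayleigh L x.
Proof.
move=> /andP[x_neq0 le_xk] le_kn ray_ge.
have form_ge0E y : (0 < norm0 y)%N ->
    (0 <= quad_form (L - c%:M) y) = (c <= rayleigh L y).
  move=> y_neq0; rewrite quad_formB -scalemx1 quad_formZ quad_form1 subr_ge0.
  by rewrite -rayleighK // ler_pM2r ?sqr_norm_gt0.
rewrite -form_ge0E //; apply: (quad_form_ge0_sparse (k := k)) => [|y yk].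
  by rewrite le_xk.
by rewrite form_ge0E ?ray_ge // yk (leq_trans x_neq0).
Qed.

Lemma sparse_eigenvalue_le L (delta : R) x :
  has_lbound [set rayleigh L y | y in [set: 'cV[R]_n]]%classic ->
  (0 < norm0 x <= Num.truncn (delta * n%:R))%N ->
  (Num.truncn (delta * n%:R) <= n)%N ->
  sparse_eigenvalue L delta <= rayleigh L x.
Proof.
move=> [c c_lb] xk le_kn; apply: rayleigh_ge_sparse xk le_kn _ => y yk.
apply: ge_inf; last by exists y.
by exists c => _ [z [_ ->]]; apply: c_lb; exists z.
Qed.

End SparseVectors.

Section GraphLaplacian.
Variables (R : realType) (V : finType) (G : sgraph V) (d : nat).
Hypotheses (d_gt0 : (0 < d)%N) (G_regular : regular G d).
Implicit Types (x : 'cV[R]_#|V|) (S : {set V}).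

Local Notation L := (laplacian_mx G R d).

Let dR_gt0 : 0 < d%:R :> R. Proof. by rewrite ltr0n. Qed.

Definition entry x (u : V) : R := x (enum_rank u) 0.

Definition vertex_indicator S : 'cV[R]_#|V| :=
  indicator_col R (enum_val @^-1: S).

Lemma norm0_entry x : norm0 x = #|supp (entry x)|.
Proof.
rewrite -(on_card_preimset (onW_bij _ (@enum_val_bij V))).
by apply: eq_card => i; rewrite !inE /entry enum_valK.
Qed.

Lemma entry_vertex_indicator S u : entry (vertex_indicator S) u = (u \in S)%:R.
Proof. by rewrite /entry mxE inE enum_rankK. Qed.

Lemma norm0_vertex_indicator S : norm0 (vertex_indicator S) = #|S|.
Proof.
by rewrite norm0_indicator_col (on_card_preimset (onW_bij _ (@enum_val_bij V))).
Qed.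

Lemma sqr_norm_entry x : sqr_norm x = \sum_u entry x u ^+ 2.
Proof. by rewrite sqr_normE (reindex _ (onW_bij _ (@enum_rank_bij V))). Qed.

Lemma quad_form_adjacency x :
  quad_form (adjacency_mx G R) x = \sum_(e in arcs G) entry x e.1 * entry x e.2.
Proof.
have reindexV := reindex _ (onW_bij _ (@enum_rank_bij V)).
rewrite quad_formE reindexV (sum_arcsE _ (fun u v => entry x u * entry x v)).
apply: eq_bigr => u _; rewrite reindexV [RHS]big_mkcond; apply: eq_bigr => v _.
by rewrite /= mxE !enum_rankK; case: adj; rewrite ?mulr1 // mulr0 mul0r.
Qed.

Lemma quad_form_laplacian x :
  d%:R * quad_form L x =
  d%:R * sqr_norm x - quad_form (adjacency_mx G R) x.
Proof.
by rewrite quad_formB quad_formZ quad_form1 mulrBr mulVKf ?gt_eqF.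
Qed.

Lemma sum_arcs_sqrB_entry x :
  \sum_(e in arcs G) (entry x e.1 - entry x e.2) ^+ 2 =
  (d%:R * quad_form L x) *+ 2.
Proof.
rewrite (sum_arcs_sqrD G_regular (entry x) (fun v => - entry x v)).
under [X in (_ + X) *+ d + _]eq_bigr do rewrite sqrrN.
under [X in _ + X *+ 2]eq_bigr do rewrite mulrN.
rewrite sumrN -quad_form_adjacency -sqr_norm_entry quad_form_laplacian; ring.
Qed.

Lemma sum_arcs_sqrD_entry x :
  \sum_(e in arcs G) (entry x e.1 + entry x e.2) ^+ 2 =
  (d%:R * (2 * sqr_norm x - quad_form L x)) *+ 2.
Proof.
rewrite (sum_arcs_sqrD G_regular) -quad_form_adjacency -sqr_norm_entry.
rewrite mulrBr quad_form_laplacian; ring.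
Qed.

Lemma rayleigh_laplacian_ge0 x : 0 <= rayleigh L x.
Proof.
rewrite divr_ge0 //; last first.
  by rewrite -/(sqr_norm x) sqr_normE sumr_ge0 // => i _; apply: sqr_ge0.
rewrite -(pmulr_rge0 _ dR_gt0) -(pmulrn_lge0 _ (ltn0Sn 1)).
by rewrite -sum_arcs_sqrB_entry sumr_ge0 // => e _; apply: sqr_ge0.
Qed.

Lemma rayleigh_vertex_indicator S :
  rayleigh L (vertex_indicator S) = (cut_size G S)%:R / (d%:R * #|S|%:R).
Proof.
have sqr_bool (b : bool) : b%:R ^+ 2 = b%:R :> R.
  by case: b; rewrite ?expr1n ?expr0n.
have norm_S : sqr_norm (vertex_indicator S) = #|S|%:R.
  rewrite sqr_norm_entry -sum_indicator; apply: eq_bigr => u _.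
  by rewrite entry_vertex_indicator sqr_bool.
have form_S : d%:R * quad_form L (vertex_indicator S) =
    (cut_size G S)%:R.
  apply: (pmulrnI (ltn0Sn 1)); rewrite -sum_arcs_sqrB_entry -sum_arcs_cut.
  apply: eq_bigr => e _; rewrite !entry_vertex_indicator.
  by case: (e.1 \in S); case: (e.2 \in S);
    rewrite ?subrr ?subr0 ?sub0r ?sqrrN ?normrN ?normr0 ?normr1 ?expr1n ?expr0n.
by rewrite -form_S -norm_S -mulf_div divff ?mul1r // gt_eqF.
Qed.

Lemma expansion_rayleigh S :
  (#|S|.*2 <= #|V|)%N -> expansion G R d S = rayleigh L (vertex_indicator S).
Proof.
move=> le_half; rewrite rayleigh_vertex_indicator /expansion (minn_idPl _) //.
by rewrite -(leq_add2l #|S|) cardsC addnn.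
Qed.

Lemma sparse_cheeger (c : R) x :
  0 <= c -> (0 < norm0 x)%N -> ((norm0 x).*2 <= #|V|)%N ->
  (forall S, (0 < #|S| <= norm0 x)%N -> c <= expansion G R d S) ->
  c ^+ 2 <= (2 - rayleigh L x) * rayleigh L x.
Proof.
move=> c_ge0 x_neq0 x_half exp_ge.
have cut_ge : cut_ratio_ge G (c * d%:R) (norm0 x).
  move=> S Sx; have [S_neq0 le_S] := andP Sx.
  rewrite -mulrA -ler_pdivlMr ?mulr_gt0 ?ltr0n //.
  rewrite -rayleigh_vertex_indicator -expansion_rayleigh ?exp_ge //.
  by rewrite (leq_trans _ x_half) // leq_double.
have le_supp : (#|supp (entry x)| <= norm0 x)%N by rewrite norm0_entry.
have := cheeger_sum_arcs (mulr_ge0 c_ge0 (ltW dR_gt0)) cut_ge le_supp.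
rewrite -sqr_norm_entry sum_arcs_sqrB_entry sum_arcs_sqrD_entry.
rewrite -(rayleighK L x_neq0); set N := sqr_norm x => bound.
have scale_gt0 : 0 < (d%:R * N *+ 2) ^+ 2.
  by rewrite exprn_gt0 // pmulrn_lgt0 // mulr_gt0 // sqr_norm_gt0.
by rewrite -(ler_pM2r scale_gt0); move: bound; congr (_ <= _); ring.
Qed.

End GraphLaplacian.

Theorem theorem2 (R : realType) (V : finType) (G : sgraph V) (d : nat)
    (delta : R)
    (d_gt0 : (0 < d)%N)
    (G_regular : regular G d)
    (delta_gt0 : 0 < delta)
    (delta_le : delta <= 1 / 2%:R)
    (delta_ge : 1 <= delta * #|V|%:R) :
  let lambda := sparse_eigenvalue (laplacian_mx G R d) delta in
  lambda <= small_set_expansion G d delta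
  /\ small_set_expansion G d delta <= Num.sqrt ((2%:R - lambda) * lambda).
Proof.
set L := laplacian_mx G R d => lambda; pose k := Num.truncn (delta * #|V|%:R).
have k_half : (k.*2 <= #|V|)%N :=
  double_truncn_half _ (ltW delta_gt0) delta_le.
have le_kV : (k <= #|V|)%N by rewrite (leq_trans _ k_half) // -addnn leq_addr.
have le_kE (S : {set V}) : (#|S| <= k)%N = (#|S|%:R <= delta * #|V|%:R).
  by rewrite truncn_ge_nat ?(le_trans ler01).
have [S [S_neq0 S_small -> S_min]] := small_set_expansion_min G d delta_ge.
have le_Sk : (#|S| <= k)%N by rewrite le_kE.
have phiE : expansion G R d S = rayleigh L (vertex_indicator R S).
  by apply: expansion_rayleigh => //; rewrite (leq_trans _ k_half) ?leq_double.
have phi_ge0 : 0 <= expansion G R d S by rewrite phiE rayleigh_laplacian_ge0.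
split.
  rewrite phiE; apply: sparse_eigenvalue_le => //.
    by exists 0 => _ [y _ <-]; apply: rayleigh_laplacian_ge0.
  by rewrite norm0_vertex_indicator card_gt0 S_neq0.
rewrite -[leLHS]ger0_norm // -sqrtr_sqr ler_wsqrtr //.
apply: le_parabola_inf => [|_ [x [xk ->]]].
  by have [x xk] := ex_norm0 R le_kV; exists (rayleigh L x), x.
rewrite -/k in xk.
apply: sparse_cheeger; rewrite ?xk ?truncn_gt0 // => T /andP[T_neq0 le_Tk].
by rewrite S_min -?le_kE // -card_gt0.
Qed.
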